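(* For every integer $n\geq 1$ the following eight identities hold: (1) $A_{O\leq N}(n)-B_{O\leq N}(n)=2D_e(n)$, where $D_e(n)$ is the number of partitions of $n$ into distinct parts with an even number of parts; (2) $\widetilde{A}_{O\leq N}(n)-\widetilde{B}_{O\leq N}(n)=D(n)$, where $D(n)$ is the number of partitions of $n$ into distinct parts; (3) $A_{O<N}(n)-B_{O<N}(n)=2H^o_{N<O}(n)$, where $H^o_{N<O}(n)$ is the number of overpartitions $\pi$ of $n$ such that non-overlined parts appear, $\widetilde{SO}(\pi)\geq\widetilde{LN}(\pi)=\widetilde{SN}(\pi)$, and $\pi$ has an odd number of overlined parts; (4) $\widetilde{A}_{O<N}(n)-\widetilde{B}_{O<N}(n)=H_{N<O}(n)$, where $H_{N<O}(n)$ is the number of overpartitions $\pi$ of $n$ such that non-overlined parts appear and $\widetilde{SO}(\pi)\geq\widetilde{LN}(\pi)=\widetilde{SN}(\pi)$; (5) $A_{N\leq O}(n)-B_{N\leq O}(n)=2\left(p''_o(n)-p''_e(n)\right)$, where $p''_o(n)$ (resp. $p''_e(n)$) is the number of partitions of $n$ in which the smallest part appears an odd (resp. even) number of times and the number of parts strictly greater than the smallest part is odd; (6) $\widetilde{A}_{N\leq O}(n)-\widetilde{B}_{N\leq O}(n)=p'_o(n)-p'_e(n)$, where $p'_o(n)$ (resp. $p'_e(n)$) is the number of partitions of $n$ in which the smallest part appears an odd (resp. even) number of times; (7) $A_{N<O}(n)-B_{N<O}(n)=2p_e(n)$, where $p_e(n)$ is the number of partitions of $n$ with an even number of parts; (8)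 $\widetilde{A}_{N<O}(n)-\widetilde{B}_{N<O}(n)=p(n)$, where $p(n)$ is the number of partitions of $n$.
   Context: A partition of $n$ is a finite non-increasing sequence of positive integers summing to $n$. An overpartition of $n$ is a partition of $n$ in which the first occurrence of each distinct part size may be overlined. A part is of size $t$ if it equals $t$ or $\overline{t}$. For an overpartition $\pi$: $\widetilde{LN}(\pi)$ (resp. $\widetilde{SN}(\pi)$) is the size of the largest (resp. smallest) non-overlined part of $\pi$ if $\pi$ has non-overlined parts, and $+\infty$ otherwise; $\widetilde{LO}(\pi)$ (resp. $\widetilde{SO}(\pi)$) is the size of the largest (resp. smallest) overlined part of $\pi$ if $\pi$ has overlined parts, and $+\infty$ otherwise. $\ell_{N\leq O}(\pi)$ (resp. $\ell_{N<O}(\pi)$) is the number of non-overlined parts of $\pi$ of size $\leq\widetilde{LO}(\pi)$ (resp. $<\widetilde{LO}(\pi)$); $\ell_{O\leq N}(\pi)$ (resp. $\ell_{O<N}(\pi)$) is the number of overlined parts of $\pi$ of size $\leq\widetilde{LN}(\pi)$ (resp. $<\widetilde{LN}(\pi)$). Define: $A_{O\leq N}(n)$ (resp. $B_{O\leq N}(n)$) = number of overpartitions $\pi$ of $n$ with $\ell_{O\leq N}(\pi)$ even (resp. odd); $\widetilde{A}_{O\leq N}(n)$ (resp. $\widetilde{B}_{O\leq N}(n)$) = number of overpartitions $\pi$ of $n$ having at least one non-overlined part with $\ell_{O\leq N}(\pi)$ even (resp. odd); $A_{O<N}(n)$, $B_{O<N}(n)$, $\widetilde{A}_{O<N}(n)$,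 $\widetilde{B}_{O<N}(n)$ are defined in the same way with $\ell_{O<N}$ in place of $\ell_{O\leq N}$; $A_{N\leq O}(n)$ (resp. $B_{N\leq O}(n)$) = number of overpartitions $\pi$ of $n$ with $\ell_{N\leq O}(\pi)$ even (resp. odd); $\widetilde{A}_{N\leq O}(n)$ (resp. $\widetilde{B}_{N\leq O}(n)$) = number of overpartitions $\pi$ of $n$ having at least one overlined part with $\ell_{N\leq O}(\pi)$ even (resp. odd); $A_{N<O}(n)$, $B_{N<O}(n)$, $\widetilde{A}_{N<O}(n)$, $\widetilde{B}_{N<O}(n)$ are defined in the same way with $\ell_{N<O}$ in place of $\ell_{N\leq O}$. *)

(* Defs.v *)
From mathcomp Require Import all_boot all_order all_algebra.

Set Implicit Arguments.
Unset Strict Implicit.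
Unset Printing Implicit Defensive.

Definition is_partition (n : nat) (s : seq nat) : bool :=
  [&& sorted geq s, 0 \notin s & sumn s == n].

(* A part is a pair (size, overlined?). Only the first occurrence of a size
   may be overlined, i.e. a part preceded by a part of the same size is not. *)
Definition part := (nat * bool)%type.

Definition is_overpartition (n : nat) (s : seq part) : bool :=
  is_partition n (unzip1 s)
  && pairwise (fun x y : part => (x.1 == y.1) ==> ~~ y.2) s.

(* A partition of n has at most n parts, all of size at most n, so the
   partitions of n are found among the sequences of length at most n over
   {0, .., n}; see num_partitionsE and num_overpartitionsE. *)
Definition pseq n (p : {bseq n of 'I_n.+1}) : seq nat :=
  [seq val x | x <- p].

Definition opseq n (p : {bseq n of ('I_n.+1 * bool)%type}) : seq part :=
  [seq (val x.1, x.2) | x <- p].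

Definition num_partitions (n : nat) (P : pred (seq nat)) : nat :=
  #|[pred p : {bseq n of 'I_n.+1} | is_partition n (pseq p) && P (pseq p)]|.

Definition num_overpartitions (n : nat) (P : pred (seq part)) : nat :=
  #|[pred p : {bseq n of ('I_n.+1 * bool)%type}
     | is_overpartition n (opseq p) && P (opseq p)]|.

(* Sizes in nat extended with +oo, represented by None. *)
Definition ext_leq (x y : option nat) : bool :=
  match x, y with
  | _, None => true
  | None, Some _ => false
  | Some a, Some b => a <= b
  end.

Definition ext_ltn (x y : option nat) : bool := ~~ ext_leq y x.

Definition largest (s : seq nat) : option nat :=
  if s is x :: t then Some (foldr maxn x t) else None.

Definition smallest (s : seq nat) : option nat :=
  if s is x :: t then Some (foldr minn x t) else None.

Definition nonov (s : seq part) : seq nat := [seq x.1 | x <- s & ~~ x.2].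
Definition ov (s : seq part) : seq nat := [seq x.1 | x <- s & x.2].

Definition LN (s : seq part) := largest (nonov s).
Definition SN (s : seq part) := smallest (nonov s).
Definition LO (s : seq part) := largest (ov s).
Definition SO (s : seq part) := smallest (ov s).

Definition has_nonov (s : seq part) : bool := nonov s != [::].
Definition has_ov (s : seq part) : bool := ov s != [::].

Definition l_NleO (s : seq part) : nat :=
  count (fun t => ext_leq (Some t) (LO s)) (nonov s).
Definition l_NltO (s : seq part) : nat :=
  count (fun t => ext_ltn (Some t) (LO s)) (nonov s).
Definition l_OleN (s : seq part) : nat :=
  count (fun t => ext_leq (Some t) (LN s)) (ov s).
Definition l_OltN (s : seq part) : nat :=
  count (fun t => ext_ltn (Some t) (LN s)) (ov s).

(* The suffix t stands for the tilde. *)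
Definition A_OleN n := num_overpartitions n (fun s => ~~ odd (l_OleN s)).
Definition B_OleN n := num_overpartitions n (fun s => odd (l_OleN s)).
Definition At_OleN n :=
  num_overpartitions n (fun s => has_nonov s && ~~ odd (l_OleN s)).
Definition Bt_OleN n :=
  num_overpartitions n (fun s => has_nonov s && odd (l_OleN s)).

Definition A_OltN n := num_overpartitions n (fun s => ~~ odd (l_OltN s)).
Definition B_OltN n := num_overpartitions n (fun s => odd (l_OltN s)).
Definition At_OltN n :=
  num_overpartitions n (fun s => has_nonov s && ~~ odd (l_OltN s)).
Definition Bt_OltN n :=
  num_overpartitions n (fun s => has_nonov s && odd (l_OltN s)).

Definition A_NleO n := num_overpartitions n (fun s => ~~ odd (l_NleO s)).
Definition B_NleO n := num_overpartitions n (fun s => odd (l_NleO s)).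
Definition At_NleO n :=
  num_overpartitions n (fun s => has_ov s && ~~ odd (l_NleO s)).
Definition Bt_NleO n :=
  num_overpartitions n (fun s => has_ov s && odd (l_NleO s)).

Definition A_NltO n := num_overpartitions n (fun s => ~~ odd (l_NltO s)).
Definition B_NltO n := num_overpartitions n (fun s => odd (l_NltO s)).
Definition At_NltO n :=
  num_overpartitions n (fun s => has_ov s && ~~ odd (l_NltO s)).
Definition Bt_NltO n :=
  num_overpartitions n (fun s => has_ov s && odd (l_NltO s)).

Definition D n := num_partitions n (fun s => uniq s).
Definition D_e n := num_partitions n (fun s => uniq s && ~~ odd (size s)).

Definition in_H_NltO (s : seq part) : bool :=
  [&& has_nonov s, ext_leq (LN s) (SO s) & LN s == SN s].
Definition H_NltO n := num_overpartitions n in_H_NltO.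
Definition Ho_NltO n :=
  num_overpartitions n (fun s => in_H_NltO s && odd (size (ov s))).

Definition mult_smallest (s : seq nat) : nat :=
  count (fun t => Some t == smallest s) s.
Definition num_gt_smallest (s : seq nat) : nat :=
  count (fun t => ext_ltn (smallest s) (Some t)) s.

Definition p'_o n := num_partitions n (fun s => odd (mult_smallest s)).
Definition p'_e n := num_partitions n (fun s => ~~ odd (mult_smallest s)).
Definition p''_o n :=
  num_partitions n (fun s => odd (mult_smallest s) && odd (num_gt_smallest s)).
Definition p''_e n :=
  num_partitions n
    (fun s => ~~ odd (mult_smallest s) && odd (num_gt_smallest s)).

Definition p n := num_partitions n (fun _ => true).
Definition p_e n := num_partitions n (fun s => ~~ odd (size s)).

Lemma card_count (T : finType) (U : eqType) (f : T -> U) (Q P : pred U)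
    (S : seq U) :
  injective f -> (forall s, Q s -> exists x, f x = s) ->
  uniq S -> (forall s, (s \in S) = Q s) ->
  #|[pred x | Q (f x) && P (f x)]| = count P S.
Proof.
move=> f_inj f_surj uS SQ.
rewrite cardE -(size_map f) -size_filter; apply/perm_size/uniq_perm.
- by rewrite map_inj_uniq ?enum_uniq.
- exact: filter_uniq.
move=> s; rewrite mem_filter SQ; apply/mapP/andP.
  by move=> [x]; rewrite mem_enum inE => /andP[Qx Px] ->.
move=> [Ps Qs]; have [x fx] := f_surj _ Qs.
by exists x; rewrite ?mem_enum ?inE fx ?Qs.
Qed.

Lemma partition_bounds n s :
  is_partition n s -> size s <= n /\ all (fun t => t <= n) s.
Proof.
move=> /and3P[_ s0 /eqP <-] {n}; elim: s s0 => //= x s IHs.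
rewrite inE negb_or eq_sym -lt0n => /andP[x0 /IHs[size_s all_s]].
split; first by rewrite -add1n leq_add.
rewrite leq_addr; apply: sub_all all_s => t /leq_trans; apply.
exact: leq_addl.
Qed.

Lemma num_partitionsE n (P : pred (seq nat)) (S : seq (seq nat)) :
  uniq S -> (forall s, (s \in S) = is_partition n s) ->
  num_partitions n P = count P S.
Proof.
apply: card_count => [x y /(inj_map val_inj)/val_inj //|s].
move=> /partition_bounds[size_s all_s].
have sz : size [seq inord t : 'I_n.+1 | t <- s] <= n by rewrite size_map.
exists (Bseq sz); rewrite /pseq /= -map_comp map_id_in // => t ts /=.
by rewrite inordK // ltnS (allP all_s).
Qed.

Lemma num_overpartitionsE n (P : pred (seq part)) (S : seq (seq part)) :
  uniq S -> (forall s, (s \in S) = is_overpartition n s) ->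
  num_overpartitions n P = count P S.
Proof.
apply: card_count => [x y eq_xy|s].
  apply: val_inj; apply: inj_map eq_xy => -[a b] [c d] /= [/val_inj -> ->].
  by [].
move=> /andP[/partition_bounds[size_s all_s] _].
have sz : size [seq (inord t.1 : 'I_n.+1, t.2) | t <- s] <= n.
  by rewrite !size_map in size_s *.
exists (Bseq sz); rewrite /opseq /= -map_comp map_id_in // => -[t b] ts /=.
by rewrite inordK // ltnS (allP all_s) //; apply/mapP; exists (t, b).
Qed.

(* Main.v *)
Require Import Defs.
From mathcomp Require Import all_boot all_order all_algebra.
Import GRing.Theory.
Local Open Scope ring_scope.

(** Toggling the overline on the first occurrence of the smallest part is an
    involution on the overpartitions of [n >= 1]. Hence the sums of two functions
    [F] and [G] over these overpartitions agree as soon as [F + F'] and [G + G']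
    agree pointwise, where the prime denotes composition with the involution.
    Partitions into distinct parts are overpartitions without non-overlined
    parts, and partitions are overpartitions without overlined parts, so each of
    the eight identities reduces to such a pointwise check. If some
    non-overlined (resp. overlined) part exceeds the smallest size, the toggle
    changes the parity of the statistic and the terms cancel; otherwise all the
    quantities involved are explicit. *)

(** * Enumerations of partitions and overpartitions, and counts as sums *)

Lemma bounded_words (T : eqType) (A : seq T) (k : nat) :
  exists W : seq (seq T),
    forall s, (size s <= k)%N -> all (mem A) s -> s \in W.
Proof.
elim: k => [|k [W WP]].
  by exists [:: [::]] => s; rewrite leqn0 => /nilP ->.
exists ([::] :: [seq x :: w | x <- A, w <- W]) => -[|x s] //= ss /andP[xA sA].
by rewrite inE; apply/allpairsP; exists (x, s); split=> //=; apply: WP.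
Qed.

Lemma enum_words (T : eqType) (A : seq T) (k : nat) (Q : pred (seq T)) :
  (forall s, Q s -> (size s <= k)%N && all (mem A) s) ->
  exists2 S : seq (seq T), uniq S & forall s, (s \in S) = Q s.
Proof.
move=> QP; have [W WP] := bounded_words _ A k.
exists (undup (filter Q W)) => [|s]; first exact: undup_uniq.
rewrite mem_undup mem_filter; case Qs: (Q s) => //=.
by apply: WP; have /andP[] := QP _ Qs.
Qed.

Lemma enum_partitions (n : nat) :
  exists2 S, uniq S & forall s, (s \in S) = is_partition n s.
Proof.
apply: (enum_words _ (iota 0 n.+1) n) => s /partition_bounds[-> /allP sn].
by apply/allP => t /sn tn; rewrite -[mem _ t]/(t \in _) mem_iota ltnS.
Qed.

Lemma enum_overpartitions (n : nat) :
  exists2 S, uniq S & forall s, (s \in S) = is_overpartition n s.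
Proof.
apply: (enum_words _ [seq (t, b) | t <- iota 0 n.+1, b <- [:: true; false]] n).
move=> s /andP[/partition_bounds[]]; rewrite size_map => -> /allP sn _.
apply/allP => -[t b] ts; apply/allpairsP; exists (t, b); split=> //.
  by rewrite mem_iota ltnS sn //; apply/mapP; exists (t, b).
by case: (b).
Qed.

Lemma num_overpartitions_sum (n : nat) (P : pred (seq part)) S :
  uniq S -> (forall s, (s \in S) = is_overpartition n s) ->
  (num_overpartitions n P)%:Z = \sum_(s <- S) (P s)%:Z.
Proof.
move=> uS SE; rewrite (num_overpartitionsE P uS SE) -sum1_count.
rewrite (big_morph Posz PoszD (erefl _)) big_mkcond /=.
by apply: eq_bigr => s _; case: (P s).
Qed.

(** * Partitions as overpartitions with all marks equal *)

Lemma eq_num_overpartitions (n : nat) (P Q : pred (seq part)) :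
  P =1 Q -> num_overpartitions n P = num_overpartitions n Q.
Proof. by move=> PQ; apply: eq_card => s; rewrite !inE PQ. Qed.

Lemma eq_num_partitions (n : nat) (P Q : pred (seq nat)) :
  (forall s, is_partition n s -> P s = Q s) ->
  num_partitions n P = num_partitions n Q.
Proof.
by move=> PQ; apply: eq_card => s; rewrite !inE; apply: andb_id2l => /PQ.
Qed.

(** Marking every part with [c] is injective, with left inverse [unzip1]. For [c = true] the
    overpartition condition forces distinct sizes; for [c = false] every partition satisfies it. *)
Lemma num_partitions_mark (n : nat) (c : bool) (P : pred (seq nat)) :
  num_partitions n
    (fun t => is_overpartition n [seq (x, c) | x <- t] && P t) =
  num_overpartitions n
    (fun s => all (fun y => y.2 == c) s && P (unzip1 s)).
Proof.
have [S uS SE] := enum_partitions n; have [S' uS' SE'] := enum_overpartitions n.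
rewrite (num_partitionsE _ uS SE) (num_overpartitionsE _ uS' SE').
have markK : cancel (map (fun x => (x, c))) (@unzip1 nat bool).
  by move=> t; rewrite /unzip1 -map_comp map_id.
rewrite -!size_filter -(size_map (map (fun x => (x, c)))).
apply/perm_size/uniq_perm; last move=> s.
- by rewrite (map_inj_uniq (can_inj markK)) filter_uniq.
- exact: filter_uniq.
rewrite mem_filter SE'; apply/mapP/andP => [[t]|[/andP[sc Ps] os]].
  rewrite mem_filter => /andP[/andP[ot Pt] _] ->; rewrite markK Pt ot.
  by split=> //; rewrite all_map; apply/andP; split=> //; apply/allP => x _ /=.
have sE : s = [seq (x, c) | x <- unzip1 s].
  rewrite /unzip1 -map_comp -[LHS]map_id; apply/eq_in_map => -[x b] /(allP sc).
  by move=> /eqP /= ->.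
exists (unzip1 s) => //; rewrite mem_filter -sE os Ps SE /=.
by case/andP: os.
Qed.

Lemma has_nonovN s : ~~ has_nonov s = all (fun y => y.2 == true) s.
Proof. by elim: s => //= -[x []]. Qed.

Lemma has_ovN s : ~~ has_ov s = all (fun y => y.2 == false) s.
Proof. by elim: s => //= -[x []]. Qed.

Lemma unzip1_ov s : all (fun y => y.2 == true) s -> unzip1 s = ov s.
Proof. by rewrite /ov; elim: s => //= -[x []] //= s IH /IH ->. Qed.

Lemma unzip1_nonov s : all (fun y => y.2 == false) s -> unzip1 s = nonov s.
Proof. by rewrite /nonov; elim: s => //= -[x []] //= s IH /IH ->. Qed.

Lemma num_distinct_partitions (n : nat) (P : pred (seq nat)) :
  num_partitions n (fun t => uniq t && P t) =
  num_overpartitions n (fun s => ~~ has_nonov s && P (ov s)).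
Proof.
transitivity (num_partitions n
    (fun t => is_overpartition n [seq (x, true) | x <- t] && P t)).
  apply: eq_num_partitions => t pt; congr (_ && _).
  rewrite /is_overpartition /unzip1 -map_comp map_id pt pairwise_map /=.
  by rewrite uniq_pairwise.
rewrite num_partitions_mark; apply: eq_num_overpartitions => s.
by rewrite has_nonovN; apply: andb_id2l => /unzip1_ov ->.
Qed.

Lemma num_partitions_nonov (n : nat) (P : pred (seq nat)) :
  num_partitions n P =
  num_overpartitions n (fun s => ~~ has_ov s && P (nonov s)).
Proof.
transitivity (num_partitions n
    (fun t => is_overpartition n [seq (x, false) | x <- t] && P t)).
  apply: eq_num_partitions => t pt.
  rewrite /is_overpartition /unzip1 -map_comp map_id pt pairwise_map /=.
  suff -> : pairwise [rel x y : nat | (x == y) ==> true] t by [].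
  by elim: (t) => //= x s ->; rewrite andbT; apply/allP => y _; exact: implybT.
rewrite num_partitions_mark; apply: eq_num_overpartitions => s.
by rewrite has_ovN; apply: andb_id2l => /unzip1_nonov ->.
Qed.

(** * The involution at the first occurrence of the smallest size *)

Definition with_smallest (u : seq part) (x : nat) (b : bool) (k : nat) :=
  u ++ (x, b) :: nseq k (x, false).

Definition exceed (x : nat) (u : seq part) := all (fun y : part => x < y.1)%N u.

Lemma unzip1_with_smallest u x b k :
  unzip1 (with_smallest u x b k) = unzip1 u ++ nseq k.+1 x.
Proof. by rewrite /unzip1 map_cat /= map_nseq. Qed.

(** Induction from the largest part: a head above the smallest size joins [u]. A head equal to it
    forces [u] to be empty, as sizes weakly decrease, and becomes the first occurrence, so the
    previous one is non-overlined. *)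
Lemma with_smallestP n s : (0 < n)%N -> is_overpartition n s ->
  exists u x b k, s = with_smallest u x b k /\ exceed x u.
Proof.
move=> n0 /andP[/and3P[]]; rewrite (sorted_pairwise (rev_trans leq_trans)).
have: s != [::] -> pairwise geq (unzip1 s) ->
    pairwise (fun x y : part => (x.1 == y.1) ==> ~~ y.2) s ->
    exists u x b k, s = with_smallest u x b k /\ exceed x u.
  elim: s => // -[x b] [|z s] IH _; first by exists [::], x, b, 0%N.
  move: {z s}(z :: s) (isT : z :: s != [::]) IH => s s0 IH.
  rewrite /= => /andP[xs ps] /andP[xs' ps'].
  have [u [y [c [k [sE yu]]]]] := IH s0 ps ps'.
  move: xs xs'; rewrite {}sE unzip1_with_smallest /with_smallest.
  rewrite !all_cat /= => /and3P[xu xy _] /and3P[_ xc _].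
  have [yx|xy'] := ltnP y x.
    by exists ((x, b) :: u), y, c, k; split=> //=; rewrite yx.
  have xyE : x = y by apply/eqP; rewrite eqn_leq xy'.
  have u0 : u = [::].
    move: xu yu; rewrite xyE; case: u => //= z u /andP[zy _] /andP[yz _].
    by move: yz; rewrite ltnNge zy.
  exists [::], x, b, k.+1; split=> //; rewrite u0 -xyE /with_smallest /=.
  by move: xc; rewrite xyE eqxx /=; case: (c).
move=> + ps _ sn ps'; apply=> //; apply: contraTneq n0 => s0.
by rewrite -(eqP sn) s0.
Qed.

Lemma is_overpartition_with_smallest n u x b k : exceed x u ->
  is_overpartition n (with_smallest u x b k) =
  is_overpartition n (with_smallest u x (~~ b) k).
Proof.
move=> xu; rewrite /is_overpartition !unzip1_with_smallest; congr (_ && _).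
rewrite !pairwise_cat /=; congr [&& _, _ & _].
rewrite !allrel_consr; congr (_ && _); apply/allP/allP => _ y /(allP xu) xy;
  by rewrite (gtn_eqF xy).
Qed.

(* On weakly decreasing sizes, the head agrees with the last size exactly at
   the first occurrence of the smallest size. *)
Fixpoint toggle (s : seq part) : seq part :=
  if s is y :: s' then
    if y.1 == last y.1 (unzip1 s') then (y.1, ~~ y.2) :: s' else y :: toggle s'
  else [::].

Lemma toggle_with_smallest u x b k : exceed x u ->
  toggle (with_smallest u x b k) = with_smallest u x (~~ b) k.
Proof.
have last_nseq (m y : nat) : last y (nseq m y) = y by elim: m.
elim: u => /= [_|y u IH /andP[xy xu]].
  by rewrite /unzip1 map_nseq last_nseq eqxx.
rewrite unzip1_with_smallest last_cat /= last_nseq (gtn_eqF xy).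
by rewrite IH.
Qed.

Lemma toggleP n s : (0 < n)%N -> is_overpartition n s ->
  is_overpartition n (toggle s) /\ toggle (toggle s) = s.
Proof.
move=> n0 os; have [u [x [b [k [sE xu]]]]] := with_smallestP n s n0 os.
rewrite sE in os *; rewrite !toggle_with_smallest // negbK.
by rewrite -is_overpartition_with_smallest.
Qed.

(** The involution permutes [S], so twice a sum over [S] is a sum over the pairs [s], [toggle s];
    doubling is injective on integers. *)
Lemma eq_sum_toggle n S (F G : seq part -> int) :
  (0 < n)%N -> uniq S -> (forall s, (s \in S) = is_overpartition n s) ->
  (forall u x k, exceed x u ->
     F (with_smallest u x true k) + F (with_smallest u x false k) =
     G (with_smallest u x true k) + G (with_smallest u x false k)) ->
  \sum_(s <- S) F s = \sum_(s <- S) G s.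
Proof.
move=> n0 uS SE FG.
have toggleS : perm_eq (map toggle S) S.
  have inS s : s \in S -> toggle s \in S /\ toggle (toggle s) = s.
    by rewrite !SE; apply: toggleP.
  apply: uniq_perm => //.
    by rewrite map_inj_in_uniq // => s t /inS[_ {2}<-] /inS[_ {2}<-] ->.
  move=> s; apply/mapP/idP => [[t /inS[tS _] ->] //|/inS[sS <-]].
  by exists (toggle s); rewrite // (inS _ sS).2; case: (inS _ sS).
have double (K : seq part -> int) :
    (\sum_(s <- S) K s) *+ 2 = \sum_(s <- S) (K s + K (toggle s)).
  by rewrite big_split /= mulr2n -{2}(perm_big _ toggleS) big_map.
apply: (@Num.Theory.pmulrnI _ 2 isT); rewrite !double.
apply: eq_big_seq => s; rewrite SE.
move=> /(with_smallestP n s n0)[u [x [b [k [-> xu]]]]].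
rewrite toggle_with_smallest //; case: b => /=; first exact: FG.
by rewrite addrC FG // addrC.
Qed.

(** * The statistics in terms of the smallest size *)

Lemma nonov_with_smallest u x b k :
  nonov (with_smallest u x b k) = nonov u ++ nseq (~~ b + k) x.
Proof.
rewrite /nonov filter_cat map_cat /=; case: b => /=;
  by rewrite filter_nseq map_nseq /= mul1n.
Qed.

Lemma ov_with_smallest u x b k :
  ov (with_smallest u x b k) = ov u ++ nseq b x.
Proof.
by rewrite /ov filter_cat map_cat /=; case: b => /=; rewrite filter_nseq.
Qed.

Lemma exceed_nonov x u : exceed x u -> all (ltn x) (nonov u).
Proof.
rewrite /nonov; elim: u => //= -[y []] u IH /andP[/= xy /IH] // ->.
by rewrite xy.
Qed.

Lemma exceed_ov x u : exceed x u -> all (ltn x) (ov u).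
Proof.
rewrite /ov; elim: u => //= -[y []] u IH /andP[/= xy /IH] // ->.
by rewrite xy.
Qed.

Lemma foldr_maxn_nseq x y m : (x <= y)%N -> foldr maxn y (nseq m x) = y.
Proof. by move=> xy; elim: m => //= m ->; apply/maxn_idPr. Qed.

Lemma foldr_minn_ge x a : all (ltn x) a -> foldr minn x a = x.
Proof. by elim: a => //= y a IH /andP[xy /IH ->]; apply/minn_idPr/ltnW. Qed.

Lemma largest_cat_nseq x a m : all (ltn x) a ->
  largest (a ++ nseq m x) =
  if a is [::] then (if m is 0 then None else Some x) else largest a.
Proof.
case: a => [_|y a /= /andP[xy _]].
  by case: m => //= m; rewrite foldr_maxn_nseq.
by rewrite foldr_cat foldr_maxn_nseq // ltnW.
Qed.

Lemma largest_gt x y a : all (ltn x) (y :: a) ->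
  exists2 z, largest (y :: a) = Some z & (x < z)%N.
Proof.
move=> /= /andP[xy xa]; eexists; first by [].
by elim: a xa => //= z a IH /andP[xz _]; rewrite leq_max xz.
Qed.

Lemma smallest_cat_nseq x a m : all (ltn x) a ->
  smallest (a ++ nseq m.+1 x) = Some x.
Proof.
have foldr_nseq y : (x <= y)%N -> foldr minn y (nseq m.+1 x) = x.
  by move=> xy; elim: m => [|m /= ->]; [apply/minn_idPl | rewrite minnn].
case: a => [_|y a].
  by congr Some; elim: m {foldr_nseq} => //= m ->; rewrite minnn.
move=> /andP[xy xa].
by rewrite [LHS]/= foldr_cat foldr_nseq 1?ltnW ?foldr_minn_ge.
Qed.

Lemma smallest_gt x y a : all (ltn x) (y :: a) ->
  exists2 z, smallest (y :: a) = Some z & (x < z)%N.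
Proof.
move=> /= /andP[xy xa]; eexists; first by [].
by elim: a xa => //= z a IH /andP[xz /IH xa]; rewrite leq_min xz.
Qed.

(** Here [a] and [m] describe the kind of parts that sets the threshold, [c] and [i] the kind being
    counted. An empty first kind gives an infinite threshold; threshold [x] admits only the copies
    of [x]; a larger one admits all [i] copies, so toggling, which changes [i] by one, flips the
    parity. *)
Lemma count_leq_largest x a c m i : all (ltn x) a -> all (ltn x) c ->
  count (fun t => ext_leq (Some t) (largest (a ++ nseq m x))) (c ++ nseq i x) =
  if a is [::] then (if m is 0 then size c + i else i)%N
  else (count (fun t => ext_leq (Some t) (largest a)) c + i)%N.
Proof.
move=> xa xc; rewrite largest_cat_nseq // count_cat count_nseq.
case: a xa => [_|y a /largest_gt[z -> xz]].
  case: m => [|m] /=; first by rewrite mul1n count_predT.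
  rewrite leqnn mul1n (eq_in_count (a2 := pred0)) ?count_pred0 // => t.
  by move=> /(allP xc) /= xt; rewrite leqNgt xt.
by rewrite /= (ltnW xz) mul1n.
Qed.

Lemma count_ltn_largest x a c m i : all (ltn x) a -> all (ltn x) c ->
  count (fun t => ext_ltn (Some t) (largest (a ++ nseq m x))) (c ++ nseq i x) =
  if a is [::] then (if m is 0 then size c + i else 0)%N
  else (count (fun t => ext_ltn (Some t) (largest a)) c + i)%N.
Proof.
move=> xa xc; rewrite largest_cat_nseq // count_cat count_nseq /ext_ltn.
case: a xa => [_|y a /largest_gt[z -> xz]].
  case: m => [|m] /=; first by rewrite mul1n count_predT.
  rewrite leqnn mul0n (eq_in_count (a2 := pred0)) ?count_pred0 // => t.
  by move=> /(allP xc) /= xt; rewrite (ltnW xt).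
by rewrite /= leqNgt xz mul1n.
Qed.

(** Suppose a non-overlined part exceeds [x]. If [x] also occurs non-overlined, [LN] and [SN]
    differ; otherwise [x] is overlined and [SO] equals [x], below [LN]. *)
Lemma in_H_NltO_with_smallest u x b k : exceed x u ->
  in_H_NltO (with_smallest u x b k) =
  (nonov u == [::]) && (0 < ~~ b + k)%N.
Proof.
move=> xu; rewrite /in_H_NltO /has_nonov /LN /SN /SO.
rewrite nonov_with_smallest ov_with_smallest.
have [xa xc] := (exceed_nonov x u xu, exceed_ov x u xu).
rewrite largest_cat_nseq //.
case: (nonov u) xa => [_|y a xya].
  case: (~~ b + k)%N => // m.
  rewrite -[nseq _ _]cat0s smallest_cat_nseq // eqxx andbT /=.
  case: b; first by rewrite (smallest_cat_nseq x _ 0) //= leqnn.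
  by rewrite cats0; case: (ov u) xc => // z c /smallest_gt[w -> /ltnW].
have [z -> xz] := largest_gt x y a xya.
case mE: (~~ b + k)%N => [|m].
  have -> : b = true by case: (b) mE.
  by rewrite (smallest_cat_nseq x _ 0) //= leqNgt xz.
rewrite smallest_cat_nseq //= andbC; case: eqP => // -[zx].
by rewrite zx ltnn in xz.
Qed.

Lemma mult_smallest_cat_nseq x a m : all (ltn x) a ->
  mult_smallest (a ++ nseq m.+1 x) = m.+1.
Proof.
move=> xa; rewrite /mult_smallest smallest_cat_nseq // count_cat count_nseq.
rewrite eqxx mul1n (eq_in_count (a2 := pred0)) ?count_pred0 // => t /(allP xa) xt /=.
by apply/eqP => -[tx]; rewrite /= tx ltnn in xt.
Qed.

Lemma num_gt_smallest_cat_nseq x a m : all (ltn x) a ->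
  num_gt_smallest (a ++ nseq m.+1 x) = size a.
Proof.
move=> xa; rewrite /num_gt_smallest smallest_cat_nseq // count_cat count_nseq.
rewrite /ext_ltn /= leqnn mul0n addn0.
rewrite (eq_in_count (a2 := predT)) ?count_predT //.
by move=> t /(allP xa) xt; rewrite -ltnNge.
Qed.

Theorem theorem1p4 (n : nat) (hn : (1 <= n)%N) :
  (A_OleN n)%:Z - (B_OleN n)%:Z = 2 * (D_e n)%:Z /\
  (At_OleN n)%:Z - (Bt_OleN n)%:Z = (D n)%:Z /\
  (A_OltN n)%:Z - (B_OltN n)%:Z = 2 * (Ho_NltO n)%:Z /\
  (At_OltN n)%:Z - (Bt_OltN n)%:Z = (H_NltO n)%:Z /\
  (A_NleO n)%:Z - (B_NleO n)%:Z = 2 * ((p''_o n)%:Z - (p''_e n)%:Z) /\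
  (At_NleO n)%:Z - (Bt_NleO n)%:Z = (p'_o n)%:Z - (p'_e n)%:Z /\
  (A_NltO n)%:Z - (B_NltO n)%:Z = 2 * (p_e n)%:Z /\
  (At_NltO n)%:Z - (Bt_NltO n)%:Z = (p n)%:Z.
Proof.
have [S uS SE] := enum_overpartitions n.
have sumE P := num_overpartitions_sum n P S uS SE.
have DE : D n = num_overpartitions n (fun s => ~~ has_nonov s && true).
  rewrite -(num_distinct_partitions n (fun=> true)).
  by apply: eq_num_partitions => s; rewrite andbT.
rewrite DE /D_e /p''_o /p''_e /p'_o /p'_e /p_e /p.
rewrite num_distinct_partitions !num_partitions_nonov.
rewrite /A_OleN /B_OleN /At_OleN /Bt_OleN /A_OltN /B_OltN /At_OltN /Bt_OltN.
rewrite /A_NleO /B_NleO /At_NleO /Bt_NleO /A_NltO /B_NltO /At_NltO /Bt_NltO.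
rewrite /H_NltO /Ho_NltO !sumE -!sumrB !mulr_sumr.
do 7?[split]; apply: (eq_sum_toggle n) => // u x k xu;
  have [xa xc] := (exceed_nonov x u xu, exceed_ov x u xu);
  rewrite ?in_H_NltO_with_smallest //;
  rewrite /l_OleN /l_OltN /l_NleO /l_NltO /has_nonov /has_ov /LN /LO;
  rewrite !nonov_with_smallest !ov_with_smallest;
  rewrite ?count_leq_largest ?count_ltn_largest //.
(* If [nonov u] is empty and [k = 0], the signs are (-1)^(r+1), with r the size of [ov u], and 1; if
   [k > 0], they are -1 and 1. *)
- case: (nonov u) => [|y a] /=; last by rewrite !oddD; case: (odd _).
  case: k => [|k] //=; rewrite !size_cat !oddD /=.
  by case: (odd _).
(* For [k = 0] the two sides count opposite members of the pair: the left one has [x] non-overlined,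
   the right one has it overlined. *)
- case: (nonov u) => [|y a] /=; last by rewrite !oddD; case: (odd _).
  by case: k.
- case: (nonov u) => [|y a] /=; last by rewrite !oddD; case: (odd _).
  (* For [k > 0] both signs are 1, and exactly one member of the pair has an odd number of overlined
     parts. *)
  by case: k => [|k] /=; rewrite !size_cat !oddD /=; case: (odd _).
- case: (nonov u) => [|y a] /=; last by rewrite !oddD; case: (odd _).
  by case: k.
(* If [ov u] is empty and r is the size of [nonov u], the signs (-1)^k and (-1)^(r+k+1) add up to
   2(-1)^k for odd r and to 0 for even r; the smallest part of the matching partition occurs [k + 1]
   times. *)
- rewrite (mult_smallest_cat_nseq _ _ k) // (num_gt_smallest_cat_nseq _ _ k) //.
  case: (ov u) => [|y c] /=; last by rewrite !oddD /=; do 2![case: (odd _)].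
  by rewrite !oddD /=; do 2![case: (odd _)].
- rewrite (mult_smallest_cat_nseq _ _ k) //.
  case: (ov u) => [|y c] /=; last by rewrite !oddD /=; do 2![case: (odd _)].
  by case: (odd _).
(* If [ov u] is empty, an overlined [x] gives 1, and a non-overlined one gives the sign of the total
   number of parts. *)
- case: (ov u) => [|y c] /=; last by rewrite !oddD /=; do 2![case: (odd _)].
  by rewrite size_cat /= size_nseq addnS /= oddD; do 2![case: (odd _)].
- case: (ov u) => [|y c] /=; last by rewrite !oddD /=; do 2![case: (odd _)].
  by [].
Qed.
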